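(* Let $\Gamma$ be a countable group, and let $\bm{a}=\Gamma\curvearrowright^a(X,\mu)$ and $\bm{b}=\Gamma\curvearrowright^b(X,\mu)$ be measure preserving actions of $\Gamma$. Suppose that $\bm{a}$ is ergodic. Let $\bm{\iota}$ denote the identity action of $\Gamma$ on a standard non-atomic probability space. If $\bm{a}\prec\bm{\iota}\times\bm{b}$ then $\bm{a}\prec\bm{b}$.
   Context: A measure preserving action $\bm{a}=\Gamma\curvearrowright^a(X,\mu)$ of a countable group $\Gamma$ is a Borel action $a$ of $\Gamma$ on a standard Borel space $X$ preserving a Borel probability measure $\mu$ on $X$; write $\gamma^a x$ for the action of $\gamma$ on $x$. Weak containment: for $\bm{a}$ on $(X,\mu)$ and $\bm{b}$ on $(Y,\nu)$, $\bm{a}\prec\bm{b}$ means that for every finite Borel partition $A_0,\dots,A_{k-1}$ of $X$, every finite $F\subseteq\Gamma$, and every $\epsilon>0$ there is a Borel partition $B_0,\dots,B_{k-1}$ of $Y$ with $|\mu(\gamma^aA_i\cap A_j)-\nu(\gamma^bB_i\cap B_j)|<\epsilon$ for all $\gamma\in F$ and $i,j<k$. $\bm{\iota}\times\bm{b}$ is the product (diagonal) action with the product measure. *)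

(* Defs.v *)
From HB Require Import structures.
From mathcomp Require Import all_boot all_order all_algebra.
From mathcomp Require Import all_classical all_reals all_analysis.
Set Implicit Arguments.
Unset Strict Implicit.
Unset Printing Implicit Defensive.
Import Order.TTheory GRing.Theory Num.Theory.
Local Open Scope classical_set_scope.
Local Open Scope ring_scope.

Section standard_borel.
Variable R : realType.

Definition separable (M : topologicalType) : Prop :=
  exists2 D : set M, countable D & dense D.

(* This is the axiom of [completeType], a structure that has no join with
   [metricType]; [cvg F] is unavailable since M need not be pointed. *)
Definition complete_metric (M : metricType R) : Prop :=
  forall F : set_system M, ProperFilter F -> cauchy F -> exists p : M, F --> p.

(* The measurable sets of X are the Borel sets of a Polish topology; the
   bijection f transports that topology from M to X. *)
Definition standard_borel d (X : measurableType d) : Prop :=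
  exists (M : metricType R) (f : X -> M),
    [/\ separable M, complete_metric M, bijective f &
        (measurable : set (set X)) =
          preimage_set_system setT f <<s (open : set (set M)) >>].

End standard_borel.

Definition nonatomic (R : realType) d (X : measurableType d)
    (mu : probability X R) : Prop :=
  forall A : set X, measurable A -> (0 < mu A)%E ->
    exists B : set X, [/\ measurable B, B `<=` A & (0 < mu B < mu A)%E].

(* Since the groups considered are countable and discrete, an action is Borel
   as soon as each group element acts by a Borel map. *)
Record mp_action (R : realType) (G : groupType) d (X : measurableType d)
    (mu : probability X R) := MpAction {
  act :> G -> X -> X;
  act1 : forall x, act 1%g x = x;
  actM : forall g h x, act (g * h)%g x = act g (act h x);
  measurable_act : forall g, measurable_fun setT (act g);
  act_preserving : forall g A, measurable A -> mu (act g @^-1` A) = mu A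
}.

Definition ergodic (R : realType) (G : groupType) d (X : measurableType d)
    (mu : probability X R) (a : mp_action G mu) : Prop :=
  forall A : set X, measurable A -> (forall g, a g @` A = A) ->
    mu A = 0%E \/ mu A = 1%E.

(* The pieces may be empty, hence this is not [partition]. *)
Definition measurable_partition d (X : measurableType d) (k : nat)
    (A : 'I_k -> set X) : Prop :=
  [/\ forall i, measurable (A i), trivIset setT A & cover setT A = setT].

Definition weakly_contained (R : realType) (G : groupType)
    d (X : measurableType d) (mu : probability X R) (a : mp_action G mu)
    d' (Y : measurableType d') (nu : probability Y R) (b : mp_action G nu) :
    Prop :=
  forall (k : nat) (A : 'I_k -> set X), measurable_partition A ->
  forall F : set G, finite_set F ->
  forall e : R, 0 < e ->
  exists2 B : 'I_k -> set Y, measurable_partition B &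
    forall g, F g -> forall i j : 'I_k,
      (`| mu ((a g @` A i) `&` A j) - nu ((b g @` B i) `&` B j) | < e%:E)%E.

Section identity_action.
Context (R : realType) (G : groupType) d (X : measurableType d).
Variable mu : probability X R.

Definition id_act (g : G) (x : X) : X := x.

Lemma id_act_measurable g : measurable_fun setT (id_act g).
Proof. exact: measurable_id. Qed.

Definition id_action : mp_action G mu :=
  @MpAction R G d X mu id_act (fun=> erefl) (fun _ _ _ => erefl)
    id_act_measurable (fun _ _ _ => erefl).

End identity_action.

Section product_probability.
Context (R : realType) d (X : measurableType d) d' (Y : measurableType d').
Variables (mu : probability X R) (nu : probability Y R).

Definition product_probability : set (X * Y) -> \bar R := (mu \x nu)%E.

HB.instance Definition _ := Measure.on product_probability.

Lemma product_probability_setT : product_probability setT = 1%E.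
Proof.
rewrite /product_probability -setXTT [LHS]product_measure1E//.
by rewrite [X in (X * _)%E]probability_setT [X in (_ * X)%E]probability_setT
  mule1.
Qed.

HB.instance Definition _ :=
  Measure_isProbability.Build _ _ _ product_probability
    product_probability_setT.

End product_probability.

Section product_action.
Context (R : realType) (G : groupType).
Context d (X : measurableType d) d' (Y : measurableType d').
Variables (mu : probability X R) (nu : probability Y R).
Variables (a : mp_action G mu) (b : mp_action G nu).

Definition prod_act (g : G) (z : X * Y) : X * Y := (a g z.1, b g z.2).

Lemma prod_act1 z : prod_act 1%g z = z.
Proof. by case: z => x y; rewrite /prod_act !act1. Qed.

Lemma prod_actM g h z : prod_act (g * h)%g z = prod_act g (prod_act h z).
Proof. by rewrite /prod_act !actM. Qed.

Lemma measurable_prod_act g : measurable_fun setT (prod_act g).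
Proof.
apply: measurable_fun_pair; apply: measurableT_comp => //;
  exact: measurable_act.
Qed.

Lemma prod_act_preserving g (A : set (X * Y)) : measurable A ->
  product_probability mu nu (prod_act g @^-1` A) = product_probability mu nu A.
Proof.
have mp := measurable_prod_act g.
pose m' := measure_function_pushforward__canonical__measure_function_Measure
  (mu \x nu)%E mp.
have E A1 A2 : measurable A1 -> measurable A2 ->
    m' (A1 `*` A2) = (mu A1 * nu A2)%E.
  move=> m1 m2.
  have -> : m' (A1 `*` A2) =
      (mu \x nu)%E ((a g @^-1` A1) `*` (b g @^-1` A2)) by [].
  have m1' : measurable (a g @^-1` A1).
    by rewrite -[X in measurable X]setTI; exact: measurable_act.
  have m2' : measurable (b g @^-1` A2).
    by rewrite -[X in measurable X]setTI; exact: measurable_act.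
  rewrite [LHS]product_measure1E//.
  by congr (_ * _)%E; exact: act_preserving.
move=> mA; rewrite /product_probability.
exact/esym/(product_measure_unique (m' := m') E).
Qed.

Definition prod_action : mp_action G (product_probability mu nu) :=
  @MpAction R G _ _ (product_probability mu nu) prod_act prod_act1 prod_actM
    measurable_prod_act prod_act_preserving.

End product_action.

(* Main.v *)
Require Import Defs.
From mathcomp Require Import all_boot all_order all_algebra.
From mathcomp Require Import all_classical all_reals all_analysis.
From mathcomp Require Import measurable_realfun ring lra.
Set Implicit Arguments.
Unset Strict Implicit.
Unset Printing Implicit Defensive.
Import Order.TTheory GRing.Theory Num.Theory.
Import numFieldNormedType.Exports.
Local Open Scope classical_set_scope.
Local Open Scope ring_scope.

(* By the mean ergodic theorem, ergodicity of [a] yields, for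
   [D = gA_i `&` A_j], a finite convex combination of translates of [\1_D] whose
   squared [L^2] norm is close to [mu(D)^2].  That norm is a finite combination
   of the numbers [mu(hD `&` D)], so weak containment, applied to a refinement
   of [A], provides a partition of [Z * X] for which the corresponding average
   is [L^2]-close to the constant [mu(D)].  As the group acts trivially on [Z],
   the mean over the slice of [X] above [z] of this average is the measure of
   the slice of [D]; hence for most [z] the slices form a partition of [X] with
   the required measures. *)

(** * Bounded measurable functions *)

Section bounded_measurable.
Context (R : realType) d (X : measurableType d) (mu : probability X R).
Implicit Types f g : X -> R.

Definition bounded_mfun f :=
  measurable_fun setT f /\ exists M, forall x, `|f x| <= M.

Lemma bounded_mfun_integrable f :
  bounded_mfun f -> mu.-integrable setT (EFin \o f).
Proof.
move=> [mf [M fM]]; apply: measurable_bounded_integrable => //.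
  by rewrite [X in (X < _)%E]probability_setT ltry.
exists M; split; first exact: num_real.
by move=> y My x _; exact: le_trans (fM x) (ltW My).
Qed.

Lemma bounded_mfun_cst c : bounded_mfun (fun=> c).
Proof. by split; [exact: measurable_cst|exists `|c|]. Qed.

Lemma bounded_mfunD f g : bounded_mfun f -> bounded_mfun g ->
  bounded_mfun (fun x => f x + g x).
Proof.
move=> [mf [M fM]] [mg [N gN]]; split; first exact: measurable_funD.
by exists (M + N) => x; rewrite (le_trans (ler_normD _ _))// lerD.
Qed.

Lemma bounded_mfunM f g : bounded_mfun f -> bounded_mfun g ->
  bounded_mfun (fun x => f x * g x).
Proof.
move=> [mf [M fM]] [mg [N gN]]; split; first exact: measurable_funM.
by exists (M * N) => x; rewrite normrM ler_pM.
Qed.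

Lemma bounded_mfunB f g : bounded_mfun f -> bounded_mfun g ->
  bounded_mfun (fun x => f x - g x).
Proof.
move=> bf [mg [N gN]]; apply: bounded_mfunD => //; split.
  exact: measurableT_comp.
by exists N => x; rewrite normrN.
Qed.

Lemma bounded_mfunX2 f : bounded_mfun f -> bounded_mfun (fun x => f x ^+ 2).
Proof. exact: (fun bf => bounded_mfunM bf bf). Qed.

Lemma bounded_mfun_norm f : bounded_mfun f -> bounded_mfun (fun x => `|f x|).
Proof.
move=> [mf [M fM]]; split; first exact: measurableT_comp.
by exists M => x; rewrite normr_id.
Qed.

Lemma bounded_mfun_indic A : measurable A -> bounded_mfun \1_A.
Proof.
move=> mA; split; first exact: measurable_indic.
by exists 1 => x; rewrite indicE; case: (x \in A); rewrite ?normr1 ?normr0.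
Qed.

Lemma bounded_mfun_sum I (s : seq I) (f : I -> X -> R) :
  (forall i, bounded_mfun (f i)) -> bounded_mfun (fun x => \sum_(i <- s) f i x).
Proof.
move=> bf; elim: s => [|i s IH].
  by under eq_fun do rewrite big_nil; exact: bounded_mfun_cst.
by under eq_fun do rewrite big_cons; exact: bounded_mfunD.
Qed.

Lemma RintegralT_cst c : \int[mu]_x c = c.
Proof.
by rewrite Rintegral_cst// [X in fine X]probability_setT mulr1.
Qed.

Lemma RintegralT_indic A : measurable A -> \int[mu]_x \1_A x = fine (mu A).
Proof. by move=> mA; rewrite /Rintegral integral_indic// setIT. Qed.

Lemma RintegralT_sum I (s : seq I) (f : I -> X -> R) :
  (forall i, bounded_mfun (f i)) ->
  \int[mu]_x (\sum_(i <- s) f i x) = \sum_(i <- s) \int[mu]_x f i x.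
Proof.
move=> bf; elim: s => [|i s IH].
  rewrite big_nil; under eq_Rintegral do rewrite big_nil.
  exact: RintegralT_cst.
rewrite big_cons -IH; under eq_Rintegral do rewrite big_cons.
rewrite RintegralD//; apply: bounded_mfun_integrable => //.
exact: bounded_mfun_sum.
Qed.

(** The variance, that is the integral of [(f x - m) ^+ 2], is nonnegative; expanding it uses that
    [mu] has total mass 1. *)
Lemma sqr_Rintegral_le f : bounded_mfun f ->
  (\int[mu]_x f x) ^+ 2 <= \int[mu]_x (f x ^+ 2).
Proof.
move=> bf; set m := \int[mu]_x f x.
have : 0 <= \int[mu]_x ((f x ^+ 2 - 2 * m * f x) + m ^+ 2).
  apply: Rintegral_ge0 => x _.
  by rewrite (_ : _ + _ = (f x - m) ^+ 2) ?sqr_ge0//; ring.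
have bmf : bounded_mfun (fun x => 2 * m * f x).
  by apply: bounded_mfunM => //; exact: bounded_mfun_cst.
rewrite RintegralD//; last 2 first.
- apply: bounded_mfun_integrable; apply: bounded_mfunB => //.
  exact: bounded_mfunX2.
- exact/bounded_mfun_integrable/bounded_mfun_cst.
rewrite RintegralT_cst RintegralB//; last 2 first.
- exact/bounded_mfun_integrable/bounded_mfunX2.
- exact: bounded_mfun_integrable.
rewrite RintegralZl//; last exact: bounded_mfun_integrable.
by rewrite -/m; lra.
Qed.

End bounded_measurable.

(** * Weighted averages of translates of a set *)

Section actions.
Context (R : realType) (G : groupType) d (X : measurableType d).
Variables (mu : probability X R) (a : mp_action G mu).

Lemma act_inv g x : a g^-1%g (a g x) = x.
Proof. by rewrite -actM mulVg act1. Qed.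

Lemma act_invr g x : a g (a g^-1%g x) = x.
Proof. by rewrite -actM mulgV act1. Qed.

(** Weak containment and ergodicity speak of images, whereas measurability and invariance are stated
    for preimages; this passes between them. *)
Lemma image_act g A : a g @` A = a g^-1%g @^-1` A.
Proof.
apply/seteqP; split => [_ [x Ax <-]|x Ax] /=; first by rewrite act_inv.
by exists (a g^-1%g x) => //; rewrite act_invr.
Qed.

Lemma image_act1 A : a 1%g @` A = A.
Proof.
by rewrite image_act invg1; apply/seteqP; split => x /=; rewrite act1.
Qed.

Lemma measurable_preimage_act g A :
  measurable A -> measurable (a g @^-1` A).
Proof.
by move=> mA; rewrite -[X in measurable X]setTI; exact: measurable_act.
Qed.

Lemma measurable_image_act g A : measurable A -> measurable (a g @` A).
Proof. by rewrite image_act; exact: measurable_preimage_act. Qed.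

Lemma bounded_mfun_act g (f : X -> R) :
  bounded_mfun f -> bounded_mfun (fun x => f (a g x)).
Proof.
move=> [mf [M fM]]; split; last by exists M.
by apply: measurableT_comp => //; exact: measurable_act.
Qed.

(** A list of pairs of a coefficient and a group element encodes a finitely supported element of the
    group ring; repetitions are allowed, so sums are concatenations. *)
Definition avg (D : set X) (w : seq (R * G)) (x : X) : R :=
  \sum_(i <- w) i.1 * \1_D (a i.2 x).

Definition autocorr (D : set X) (w : seq (R * G)) : R :=
  \sum_(i <- w) \sum_(j <- w)
    i.1 * j.1 * fine (mu (a (j.2 * i.2^-1)%g @` D `&` D)).

Definition weights (w : seq (R * G)) :=
  all (fun i => 0 <= i.1) w && (\sum_(i <- w) i.1 == 1).

Variable D : set X.
Hypothesis mD : measurable D.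

Let bounded_mfun_shift (i : R * G) :
  bounded_mfun (fun x => i.1 * \1_D (a i.2 x)).
Proof.
apply: bounded_mfunM; first exact: bounded_mfun_cst.
exact/(@bounded_mfun_act _ \1_D)/bounded_mfun_indic.
Qed.

Lemma bounded_mfun_avg w : bounded_mfun (avg D w).
Proof. exact: bounded_mfun_sum. Qed.

Lemma avg_cat w1 w2 x : avg D (w1 ++ w2) x = avg D w1 x + avg D w2 x.
Proof. exact: big_cat. Qed.

Lemma avg_scale c w x :
  avg D [seq (c * i.1, i.2) | i <- w] x = c * avg D w x.
Proof.
rewrite /avg big_map mulr_sumr; apply: eq_bigr => i _ /=.
by rewrite mulrA.
Qed.

Lemma avg_shift h w x :
  avg D [seq (i.1, (i.2 * h)%g) | i <- w] x = avg D w (a h x).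
Proof. by rewrite /avg big_map; apply: eq_bigr => i _ /=; rewrite actM. Qed.

Lemma avg_ge0 w x : weights w -> 0 <= avg D w x.
Proof.
move=> /andP[/allP w0 _]; rewrite /avg big_seq sumr_ge0// => i iw.
by rewrite mulr_ge0 ?w0.
Qed.

Lemma avg_le1 w x : weights w -> avg D w x <= 1.
Proof.
move=> /andP[/allP w0 /eqP <-]; rewrite /avg big_seq [leRHS]big_seq.
apply: ler_sum => i iw; rewrite ler_piMr ?w0//.
Qed.

Lemma Rintegral_avg w : weights w -> \int[mu]_x avg D w x = fine (mu D).
Proof.
move=> /andP[_ /eqP w1]; rewrite RintegralT_sum//.
under eq_bigr => i _.
  rewrite RintegralZl//; last first.
    apply: bounded_mfun_integrable.
    exact/(@bounded_mfun_act _ \1_D)/bounded_mfun_indic.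
  rewrite (_ : (fun x => _) = \1_(a i.2 @^-1` D))//.
  rewrite RintegralT_indic; last exact: measurable_preimage_act.
  rewrite act_preserving//.
  over.
by rewrite -mulr_suml w1 mul1r.
Qed.

Lemma Rintegral_avg_sqr w : \int[mu]_x (avg D w x ^+ 2) = autocorr D w.
Proof.
pose E (i j : R * G) := a i.2 @^-1` D `&` a j.2 @^-1` D.
have mE i j : measurable (E i j).
  by apply: measurableI; exact: measurable_preimage_act.
under eq_Rintegral => x _.
  rewrite expr2 {1}/avg mulr_suml.
  under eq_bigr do rewrite mulr_sumr.
  over.
have eqE i j : (fun x => i.1 * \1_D (a i.2 x) * (j.1 * \1_D (a j.2 x))) =
    (fun x => i.1 * j.1 * \1_(E i j) x).
  apply/funext => x; rewrite /E indicI /= mulrACA; congr (_ * _).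
rewrite RintegralT_sum; last first.
  by move=> i; apply: bounded_mfun_sum => j; exact: bounded_mfunM.
apply: eq_bigr => i _; rewrite RintegralT_sum; last first.
  by move=> j; exact: bounded_mfunM.
apply: eq_bigr => j _; rewrite eqE RintegralZl//; last first.
  exact/bounded_mfun_integrable/bounded_mfun_indic.
rewrite RintegralT_indic//; congr (_ * fine _).
(* Pulling out the action of [j.2], which preserves [mu], leaves one relative translate. *)
have -> : E i j = a j.2 @^-1` (a (j.2 * i.2^-1)%g @` D `&` D).
  rewrite image_act; apply/seteqP; split => x /=.
    by move=> [? ?]; split=> //; rewrite -actM invgM invgK mulgVK.
  by move=> [+ ?]; rewrite -actM invgM invgK mulgVK.
apply: act_preserving; apply: measurableI => //.
exact: measurable_image_act.
Qed.

Lemma sqr_le_autocorr w : weights w -> fine (mu D) ^+ 2 <= autocorr D w.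
Proof.
move=> w1; rewrite -Rintegral_avg_sqr -(Rintegral_avg w1).
by apply: sqr_Rintegral_le; exact: bounded_mfun_avg.
Qed.

End actions.

Lemma countable_enum (T : choiceType) (x0 : T) :
  countable [set: T] -> exists e : nat -> T, forall x, exists n, e n = x.
Proof.
move=> /countable_injP[f finj].
(* The default [x0] fills the indices outside the range of the injection [f]. *)
exists (fun n => xget x0 [set x | f x = n]) => x; exists (f x).
case: xgetP => [y _ fy|/(_ x) []//].
by apply: finj fy; rewrite inE.
Qed.

(** * The mean ergodic theorem *)

Section summable.
Context (R : realType) d (X : measurableType d) (mu : probability X R).

(** The integrals sum to at most [C], so by monotone convergence the sum is integrable and therefore
    finite almost everywhere; there the nondecreasing partial sums are bounded. *)
Lemma ae_cvg_series (u : nat -> X -> R) (C : R) :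
  0 <= C ->
  (forall n, bounded_mfun (u n)) -> (forall n x, 0 <= u n x) ->
  (forall n, \int[mu]_x u n x <= C / (2 ^ n.+1)%:R) ->
  {ae mu, forall x, cvgn (series (u ^~ x))}.
Proof.
move=> C0 bu u0 uC.
have mu_ n : measurable_fun setT (EFin \o u n).
  by apply/measurable_EFinP; case: (bu n).
pose S x := (\sum_(n <oo) (u n x)%:E)%E.
have mS : measurable_fun setT S.
  by apply: ge0_emeasurable_sum => n *; [rewrite lee_fin|exact: mu_].
have S0 x : (0 <= S x)%E by apply: nneseries_ge0 => n _ _; rewrite lee_fin.
have iS : mu.-integrable setT S.
  apply/integrableP; split => //.
  under eq_integral do rewrite gee0_abs//.
  rewrite integral_nneseries//.
  - apply: (@le_lt_trans _ _ C%:E); last exact: ltry.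
    apply: (le_trans _ (@epsilon_trick0 R C xpredT C0)).
    apply: lee_nneseries => [n _ _|n _].
      by apply: integral_ge0 => x _; rewrite lee_fin.
    have := uC n; rewrite -lee_fin; congr (_ <= _)%E.
    by rewrite fineK// integrable_fin_num//; exact: bounded_mfun_integrable.
  - by move=> n x _; rewrite lee_fin.
apply: filterS (integrable_ae measurableT iS) => x /(_ I) fS.
apply: nondecreasing_is_cvgn.
  by apply/nondecreasing_seqP => n; rewrite seriesSr lerDl.
exists (fine (S x)) => _ [n _ <-]; rewrite -lee_fin fineK//.
rewrite seriesEnat /= -sumEFin.
by apply: nneseries_lim_ge => k _ _; rewrite lee_fin.
Qed.

(** An $L^2$ bound becomes an $L^1$ bound through $t \le p t^2 + p^{-1}$ with $p = 2^n$: the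
    integral of [|u n|] is at most $(C + 1) / 2^n$, which is summable. *)
Lemma L2_summable_ae (u : nat -> X -> R) (C : R) :
  0 <= C ->
  (forall n, bounded_mfun (u n)) ->
  (forall n, \int[mu]_x (u n x ^+ 2) <= C / (4 ^ n)%:R) ->
  {ae mu, forall x, cvgn [normed series (u ^~ x)]}.
Proof.
move=> C0 bu uC.
apply: (@ae_cvg_series (fun n x => `|u n x|) (C + 1 + (C + 1))) => //.
- by rewrite addr_ge0// addr_ge0.
- by move=> n; exact: bounded_mfun_norm.
move=> n; have p0 : 0 < (2 ^ n)%:R :> R by rewrite ltr0n expn_gt0.
have bu2 : bounded_mfun (fun x => (2 ^ n)%:R * u n x ^+ 2).
  by apply: bounded_mfunM; [exact: bounded_mfun_cst|exact: bounded_mfunX2].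
apply: (@le_trans _ _ (\int[mu]_x ((2 ^ n)%:R * u n x ^+ 2 + (2 ^ n)%:R^-1))).
  apply: le_Rintegral => //.
  - exact/bounded_mfun_integrable/bounded_mfun_norm.
  - apply/bounded_mfun_integrable/bounded_mfunD => //.
    exact: bounded_mfun_cst.
  move=> x _; rewrite -[u n x ^+ 2]real_normK ?num_real//.
  set t := `|_|; set p := _%:R in p0 *.
  have h : 0 <= (p * t - 1) ^+ 2 + p * t.
    by rewrite addr_ge0 ?sqr_ge0 ?mulr_ge0 ?(ltW p0) ?normr_ge0.
  rewrite -subr_ge0.
  rewrite (_ : _ - t = p^-1 * ((p * t - 1) ^+ 2 + p * t)).
    by rewrite mulr_ge0// invr_ge0 ltW.
  by field; rewrite gt_eqF.
rewrite RintegralD//; last 2 first.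
- exact: bounded_mfun_integrable.
- exact/bounded_mfun_integrable/bounded_mfun_cst.
rewrite RintegralT_cst RintegralZl//; last first.
  exact/bounded_mfun_integrable/bounded_mfunX2.
apply: (@le_trans _ _ ((2 ^ n)%:R * (C / (4 ^ n)%:R) + (2 ^ n)%:R^-1)).
  by rewrite lerD2r ler_pM2l.
rewrite (_ : 4 ^ n = 2 ^ n * 2 ^ n)%N; last by rewrite -expnMn.
rewrite expnS !natrM; set p := _%:R in p0 *.
rewrite le_eqVlt; apply/orP; left; apply/eqP.
by field; rewrite gt_eqF.
Qed.

End summable.

Section ergodic.
Context (R : realType) (G : groupType) d (X : measurableType d).
Variables (mu : probability X R) (a : mp_action G mu) (D : set X).
Hypothesis mD : measurable D.

Lemma weights_mid w w' : weights w -> weights w' ->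
  weights ([seq (2^-1 * i.1, i.2) | i <- w] ++
           [seq (2^-1 * i.1, i.2) | i <- w'] : seq (R * G)).
Proof.
move=> /andP[w0 /eqP w1] /andP[w'0 /eqP w'1]; apply/andP; split.
  rewrite all_cat !all_map; apply/andP; split.
    by apply/sub_all/w0 => i /= ?; rewrite mulr_ge0.
  by apply/sub_all/w'0 => i /= ?; rewrite mulr_ge0.
rewrite big_cat !big_map /= -!mulr_sumr w1 w'1.
by apply/eqP; lra.
Qed.

Lemma weights_shift (w : seq (R * G)) h :
  weights w -> weights [seq (i.1, (i.2 * h)%g) | i <- w].
Proof. by rewrite /weights all_map big_map. Qed.

(** Right multiplication by [h] cancels in [j.2 * i.2^-1], so a translate of a nearly minimal
    average is again nearly minimal. *)
Lemma autocorr_shift w h :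
  autocorr a D [seq (i.1, (i.2 * h)%g) | i <- w] = autocorr a D w.
Proof.
rewrite /autocorr big_map; apply: eq_bigr => i _.
rewrite big_map; apply: eq_bigr => j _ /=.
by rewrite invgM mulgA mulgK.
Qed.

(* Parallelogram identity: a convex combination of translates of [\1_D] whose
   norm is nearly minimal is close to any other such combination. *)
Lemma avg_dist (q : R) w w' :
  (forall v, weights v -> q <= autocorr a D v) -> weights w -> weights w' ->
  \int[mu]_x ((avg a D w x - avg a D w' x) ^+ 2) <=
    2 * (autocorr a D w - q) + 2 * (autocorr a D w' - q).
Proof.
move=> qmin ww ww'; have := qmin _ (weights_mid ww ww').
rewrite -!Rintegral_avg_sqr//; set v := _ ++ _.
have b w0 : bounded_mfun (avg a D w0) by exact: bounded_mfun_avg.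
have b2 w0 : bounded_mfun (fun x => avg a D w0 x ^+ 2) by exact: bounded_mfunX2.
have bZ c w0 : bounded_mfun (fun x => c * avg a D w0 x ^+ 2).
  by apply: bounded_mfunM => //; exact: bounded_mfun_cst.
have -> : \int[mu]_x ((avg a D w x - avg a D w' x) ^+ 2) =
    \int[mu]_x (2 * avg a D w x ^+ 2 + 2 * avg a D w' x ^+ 2 -
                4 * avg a D v x ^+ 2).
  apply: eq_Rintegral => x _; rewrite /v avg_cat !avg_scale.
  by field.
rewrite RintegralB//; last 2 first.
- by apply: bounded_mfun_integrable; exact: bounded_mfunD.
- exact: bounded_mfun_integrable.
rewrite RintegralD//; try exact: bounded_mfun_integrable.
rewrite !RintegralZl//; try exact: bounded_mfun_integrable.
by lra.
Qed.

End ergodic.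

Section ergodic.
Context (R : realType) (G : groupType) d (X : measurableType d).
Variables (mu : probability X R) (a : mp_action G mu).

(* The set of points whose whole orbit satisfies [F <= p] is strictly
   invariant. *)
Lemma ergodic_ae_dichotomy (F : X -> \bar R) (p : \bar R) :
  countable [set: G] -> ergodic a -> measurable_fun setT F ->
  (forall g, {ae mu, forall x, F (a g x) = F x}) ->
  {ae mu, forall x, (F x <= p)%E} \/ {ae mu, forall x, (p <= F x)%E}.
Proof.
move=> /(countable_enum 1%g)[e eG] erg mF Finv.
pose E := [set x | forall g, (F (a g x) <= p)%E].
have mE : measurable E.
  have -> : E = \bigcap_n (a (e n) @^-1` [set x | (F x <= p)%E]).
    apply/seteqP; split => [x Ex n _ //=|x Ex g].
    by have [n <-] := eG g; exact: Ex.
  apply: bigcapT_measurable => n; apply: measurable_preimage_act.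
  rewrite -[X in measurable X]setTI.
  exact: emeasurable_fun_infty_c.
have invE g : a g @` E = E.
  rewrite image_act; apply/seteqP; split => x /= Ex h.
    by have := Ex (h * g)%g; rewrite -actM mulgK.
  by rewrite -actM.
(* Countability of the group lets a single null set serve all its elements. *)
have aeF : {ae mu, forall x, forall n, F (a (e n) x) = F x}.
  by apply: ae_foralln => n; exact: Finv.
have [E0|E1] := erg E mE invE; [right|left].
  have aeNE : {ae mu, forall x, ~ E x}.
    by exists E; split => // x /=; rewrite notE.
  apply: filterS2 aeF aeNE => x Fx /existsNP[g /negP].
  by have [n <-] := eG g; rewrite Fx -ltNge => /ltW.
have aeE : {ae mu, forall x, E x}.
  exists (~` E); split => //; first exact: measurableC.
  by rewrite probability_setC// [X in (1 - X)%E]E1 subee.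
by apply: filterS aeE => x /(_ 1%g); rewrite act1.
Qed.

Lemma cvg_Rintegral_bounded (f : nat -> X -> R) (F : X -> \bar R) (M : R) :
  (forall n, bounded_mfun (f n)) -> (forall n x, `|f n x| <= M) ->
  measurable_fun setT F ->
  {ae mu, forall x, (f n x)%:E @[n --> \oo] --> F x} ->
  mu.-integrable setT F /\
  (\int[mu]_x f n x)%:E @[n --> \oo] --> (\int[mu]_x F x)%E.
Proof.
move=> bf fM mF fF.
have mf n : measurable_fun setT (EFin \o f n).
  by apply/measurable_EFinP; case: (bf n).
have iM : mu.-integrable setT (fun=> M%:E).
  exact/bounded_mfun_integrable/bounded_mfun_cst.
have [] := @dominated_convergence _ _ _ mu setT measurableT
  (fun n => EFin \o f n) F (fun=> M%:E) mf mF _ iM.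
- by apply: filterS fF.
- by apply: aeW => x n _; rewrite lee_fin.
move=> iF _ limF; split => //; apply: cvg_trans limF.
apply: near_eq_cvg; apply: nearW => n /=.
by rewrite fineK// integrable_fin_num//; exact: bounded_mfun_integrable.
Qed.

(** A function lying on one side of its own mean equals it almost everywhere: the difference, with
    the right sign, is nonnegative with integral 0. *)
Lemma ae_le_eq_cst (F : X -> \bar R) (p : R) :
  mu.-integrable setT F -> (\int[mu]_x F x)%E = p%:E ->
  {ae mu, forall x, (F x <= p%:E)%E} \/ {ae mu, forall x, (p%:E <= F x)%E} ->
  {ae mu, forall x, F x = p%:E}.
Proof.
move=> iF Fp dich.
have ip : mu.-integrable setT (fun=> p%:E).
  exact/bounded_mfun_integrable/bounded_mfun_cst.
have mF := measurable_int _ iF.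
have mB : measurable_fun setT (fun x => p%:E - F x)%E.
  exact: measurable_int _ (integrableB measurableT ip iF).
have mB' : measurable_fun setT (fun x => F x - p%:E)%E.
  exact: measurable_int _ (integrableB measurableT iF ip).
have cp : (\int[mu]_x p%:E = p%:E)%E.
  by rewrite integral_cst//= [X in (_ * X)%E]probability_setT mule1.
have fF := integrable_ae measurableT iF.
suff : ae_eq mu setT (fun x => p%:E - F x)%E (cst 0%E).
  apply: filterS2 fF => x /(_ I) fx /(_ I) /= /eqP.
  by rewrite sube_eq// add0e => /eqP ->.
apply/(ae_eq_integral_abs mu measurableT mB).
case: dich => h.
  transitivity (\int[mu]_x (p%:E - F x))%E.
    apply: ae_eq_integral => //; first exact: measurableT_comp.
    by apply: filterS h => x Fx _; rewrite gee0_abs// sube_ge0//= orbT.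
  by rewrite integralB// cp Fp subee.
transitivity (\int[mu]_x (F x - p%:E))%E.
  apply: ae_eq_integral => //; first exact: measurableT_comp.
  apply: filterS2 fF h => x /(_ I) fx Fx _.
  by rewrite lee0_abs ?sube_le0// fin_num_oppeB// addeC.
by rewrite integralB// cp Fp subee.
Qed.

Variable D : set X.
Hypothesis mD : measurable D.

(** Averages whose norms approach the infimum converge almost everywhere. Since their translates
    approach it too, the limit is invariant, hence by ergodicity the constant $\mu(D)$, and the
    squared norms tend to $\mu(D)^2$. *)
Lemma ergodic_autocorr (e : R) : countable [set: G] -> ergodic a -> 0 < e ->
  exists2 w, weights w & autocorr a D w < fine (mu D) ^+ 2 + e.
Proof.
move=> cG erg e0; pose S := [set autocorr a D w | w in [set w | weights w]].
have S0 : has_inf S.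
  split; last first.
    exists 0 => _ [w ww <-].
    by apply: le_trans (sqr_le_autocorr a mD ww); exact: sqr_ge0.
  exists (autocorr a D [:: (1, 1%g)]); exists [:: (1, 1%g)] => //=.
  by rewrite /weights /= ler01 big_seq1 /=.
pose q := inf S.
have qmin v : weights v -> q <= autocorr a D v.
  by move=> wv; apply: ge_inf; [case: S0|exists v].
(* The rate $4^{-n}$ is the one that [L2_summable_ae] asks for, so no passage to a subsequence is
   necessary. *)
have /choice[w ww] n :
    exists w, weights w /\ autocorr a D w < q + (4 ^ n)%:R^-1.
  have [||_ [w ww <-] ?] := @inf_adherent _ S (4 ^ n)%:R^-1; last by exists w.
    by rewrite invr_gt0 ltr0n expn_gt0.
  by [].
pose f n := avg a D (w n).
have f0 n x : 0 <= f n x by apply: avg_ge0; case: (ww n).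
have f1 n x : f n x <= 1 by apply: avg_le1; case: (ww n).
have bf n : bounded_mfun (f n) by exact: bounded_mfun_avg.
have mf n : measurable_fun setT (EFin \o f n).
  by apply/measurable_EFinP; case: (bf n).
have four n : (4 ^ n.+1)%:R^-1 <= (4 ^ n)%:R^-1 :> R.
  by rewrite lef_pV2 ?posrE ?ltr0n ?expn_gt0// ler_nat leq_exp2l.
have cvgf : {ae mu, forall x, cvgn (f ^~ x)}.
  have : {ae mu, forall x, cvgn [normed series (fun n => f n.+1 x - f n x)]}.
    (* The constant 4 comes from [avg_dist]: both averages are within $4^{-n}$ of the infimum, each
       with factor 2. *)
    apply: (@L2_summable_ae _ _ _ _ (fun n x => f n.+1 x - f n x) 4) => // n.
      exact: bounded_mfunB.
    have [w0 q0] := ww n; have [w1 q1] := ww n.+1.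
    by apply: le_trans (avg_dist mD qmin w1 w0) _; have := four n; lra.
  apply: filterS => x /normed_cvg cx.
  have -> : f ^~ x = (fun n => f 0%N x + series (fun n => f n.+1 x - f n x) n).
    by apply/funext => n; rewrite [LHS](eq_sum_telescope (f ^~ x) n).
  by apply: is_cvgD => //; exact: is_cvg_cst.
have cvgfg g : {ae mu, forall x, f n (a g x) - f n x @[n --> \oo] --> 0}.
  have : {ae mu, forall x, cvgn [normed series (fun n => f n (a g x) - f n x)]}.
    apply: (@L2_summable_ae _ _ _ _ (fun n x => f n (a g x) - f n x) 4) => // n.
      by apply: bounded_mfunB => //; exact: bounded_mfun_act.
    have [w0 q0] := ww n; have w1 := weights_shift g w0.
    under eq_Rintegral do rewrite /f -avg_shift.
    apply: le_trans (avg_dist mD qmin w1 w0) _.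
    by rewrite autocorr_shift; lra.
  by apply: filterS => x /normed_cvg /cvg_series_cvg_0.
(* The upper limit is defined and measurable on all of [X] and agrees with the limit wherever that
   exists. *)
pose F x := limn_esup (fun n => (f n x)%:E).
have mF : measurable_fun setT F by exact: measurable_fun_limn_esup.
have FE x l : f n x @[n --> \oo] --> l -> F x = l%:E.
  move=> fl; have fl' : (f n x)%:E @[n --> \oo] --> l%:E.
    by apply: cvg_EFin => //; exact: nearW.
  by have [_] := cvg_limn_einf_sup fl'.
have cvgF : {ae mu, forall x, (f n x)%:E @[n --> \oo] --> F x}.
  apply: filterS cvgf => x /cvg_ex[l fl].
  by rewrite (FE _ _ fl); apply: cvg_EFin => //; exact: nearW.
have Finv g : {ae mu, forall x, F (a g x) = F x}.
  apply: filterS2 cvgf (cvgfg g) => x /cvg_ex[l fl] fg.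
  rewrite (FE _ _ fl) (FE _ l)// -[l]add0r.
  have -> : (fun n => f n (a g x)) = (fun n => (f n (a g x) - f n x) + f n x).
    by apply/funext => n; rewrite subrK.
  exact: cvgD.
have f01 n x : `|f n x| <= 1 by rewrite ger0_norm ?f0.
have [iF limF] := cvg_Rintegral_bounded bf f01 mF cvgF.
(* Every [f n] has mean $\mu(D)$, and dominated convergence carries this to the limit. *)
have intF : (\int[mu]_x F x)%E = (fine (mu D))%:E.
  rewrite -(cvg_lim _ limF)//; apply: lim_near_cst => //.
  by apply: nearW => n; rewrite Rintegral_avg//; case: (ww n).
have aeF : {ae mu, forall x, F x = (fine (mu D))%:E}.
  exact: (ae_le_eq_cst iF intF (ergodic_ae_dichotomy _ cG erg mF Finv)).
have f201 n x : `|f n x ^+ 2| <= 1 by rewrite normrX exprn_ile1.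
have cvgF2 : {ae mu, forall x,
    (f n x ^+ 2)%:E @[n --> \oo] --> (fine (mu D) ^+ 2)%:E}.
  apply: filterS2 cvgf aeF => x /cvg_ex[l fl].
  rewrite (FE _ _ fl) => -[<-]; apply: cvg_EFin; first exact: nearW.
  by under eq_fun do rewrite /= expr2; rewrite expr2; exact: cvgM.
have [_] := cvg_Rintegral_bounded (fun n => bounded_mfunX2 (bf n)) f201
  (measurable_cst _) cvgF2.
rewrite integral_cst//= [X in (_ * X)%E]probability_setT mule1.
move=> /fine_cvgP[_] /= lim2.
have [n _ /(_ n (leqnn n))] : \forall n \near \oo,
    \int[mu]_x (f n x ^+ 2) < fine (mu D) ^+ 2 + e.
  by apply: (cvgr_lt _ lim2); rewrite ltrDl.
by rewrite /= /f Rintegral_avg_sqr//; exists (w n) => //; case: (ww n).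
Qed.

End ergodic.

(** * Weak containment for finite-valued maps *)

Section finite_valued.
Context d (X : measurableType d) (T : finType).

(** A labelling by a finite type stands for a measurable partition. Quantifying over predicates
    makes unions of pieces measurable at once. *)
Definition finite_mfun (f : X -> T) :=
  forall P : pred T, measurable [set x | P (f x)].

Lemma finite_mfunP (f : X -> T) :
  (forall t, measurable [set x | f x = t]) -> finite_mfun f.
Proof.
move=> mf P.
have -> : [set x | P (f x)] = \bigcup_(t in [set` P]) [set x | f x = t].
  by apply/seteqP; split => [x Px|x [t Pt /= ->]]//; exists (f x).
exact: fin_bigcup_measurable.
Qed.

Lemma finite_mfun_pr (R : realType) (mu : probability X R) (f : X -> T)
    (P : pred T) : finite_mfun f ->
  fine (mu [set x | P (f x)]) =
  \sum_t (P t)%:R * fine (mu [set x | f x = t]).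
Proof.
move=> mf; have mt t : measurable [set x | f x = t].
  have -> : [set x | f x = t] = [set x | pred1 t (f x)].
    by apply/seteqP; split => x /eqP.
  exact: mf.
rewrite -RintegralT_indic//.
under [RHS]eq_bigr => t _.
  rewrite -RintegralT_indic// -RintegralZl//; last first.
    exact/bounded_mfun_integrable/bounded_mfun_indic.
  over.
rewrite -RintegralT_sum; last first.
  move=> t; apply: bounded_mfunM; first exact: bounded_mfun_cst.
  exact: bounded_mfun_indic.
apply: eq_Rintegral => x _; rewrite (bigD1 (f x))//= big1 ?addr0.
  rewrite !indicE [X in _ * (nat_of_bool X)%:R]mem_set// mulr1.
  by congr ((nat_of_bool _)%:R); apply/idP/idP; rewrite inE.
move=> t /eqP tf; rewrite indicE memNset ?mulr0//.
by move=> /esym.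
Qed.

End finite_valued.

Lemma partition_finite_mfun d (X : measurableType d) k (A : 'I_k -> set X) :
  measurable_partition A ->
  exists2 f : X -> 'I_k, finite_mfun f & forall i, A i = [set x | f x = i].
Proof.
move=> [mA tA cA].
have /choice[f Af] x : exists i, A i x.
  have : setT x by [].
  by rewrite -cA => -[i _ Aix]; exists i.
have fA i : A i = [set x | f x = i].
  apply/seteqP; split => [x Aix /=|x <-//].
  by apply: (tA) => //; exists x.
exists f => // P.
have -> : [set x | P (f x)] = \bigcup_(i in [set` P]) A i.
  apply/seteqP; split => [x Px|x [i Pi]]; first by exists (f x).
  by rewrite fA /= => ->.
exact: fin_bigcup_measurable.
Qed.

Lemma finite_mfun_partition d (X : measurableType d) k (f : X -> 'I_k) :
  finite_mfun f -> measurable_partition (fun i => [set x | f x = i]).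
Proof.
move=> mf; split.
- move=> i; have -> : [set x | f x = i] = [set x | pred1 i (f x)].
    by apply/seteqP; split => x /eqP.
  exact: mf.
- apply/trivIsetP => i j _ _ /eqP ij; apply/seteqP; split => x // [/= xi xj].
  by apply: ij; rewrite -xi -xj.
- by apply/seteqP; split => x // _; exists (f x).
Qed.

Lemma finite_mfun_comp d (X : measurableType d) (T U : finType) (f : X -> T)
  (h : T -> U) : finite_mfun f -> finite_mfun (h \o f).
Proof. by move=> mf P; exact: (mf (P \o h)). Qed.

Section weak_containment.
Context (R : realType) (G : groupType).
Context d (X : measurableType d) (mu : probability X R) (a : mp_action G mu).

Lemma finite_mfun_pair (T : finType) (f : X -> T) g : finite_mfun f ->
  finite_mfun (fun x => (f (a g^-1%g x), f x)).
Proof.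
move=> mf; apply: finite_mfunP => -[s t].
have -> : [set x | (f (a g^-1%g x), f x) = (s, t)] =
    a g^-1%g @^-1` [set x | pred1 s (f x)] `&` [set x | pred1 t (f x)].
  apply/seteqP; split => [x [/= -> ->]|x [/= /eqP -> /eqP ->]] //=.
by apply: measurableI => //; exact: measurable_preimage_act.
Qed.

(** The intersection is an event of the labelling of [x] by the pair [(f (a g^-1 x), f x)], so its
    measure splits over the values of that pair. *)
Lemma finite_mfun_joint_pr (T : finType) (f : X -> T) g (P Q : pred T) :
  finite_mfun f ->
  fine (mu (a g @` [set x | P (f x)] `&` [set x | Q (f x)])) =
  \sum_(u : T * T) (P u.1 && Q u.2)%:R *
    fine (mu (a g @` [set x | f x = u.1] `&` [set x | f x = u.2])).
Proof.
move=> mf; have := finite_mfun_pr mu (fun u => P u.1 && Q u.2)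
  (finite_mfun_pair g mf).
have -> : [set x | P (f (a g^-1%g x)) && Q (f x)] =
    a g @` [set x | P (f x)] `&` [set x | Q (f x)].
  by rewrite image_act; apply/seteqP; split => x /andP.
move=> ->; apply: eq_bigr => -[s t] _; congr (_ * fine (mu _)).
rewrite image_act; apply/seteqP; split => x /=; first by case.
by move=> [-> ->].
Qed.

End weak_containment.

Section weak_containment.
Context (R : realType) (G : groupType).
Context d (X : measurableType d) (mu : probability X R) (a : mp_action G mu).

(** One labelling [f'] serves all unions of pieces simultaneously: the errors on single pieces are
    summed over all pairs of labels. *)
Lemma weakly_contained_mfun d' (Y : measurableType d') (nu : probability Y R)
    (b : mp_action G nu) (T : finType) (f : X -> T) (F : seq G) (e : R) :
  weakly_contained a b -> finite_mfun f -> 0 < e ->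
  exists2 f' : Y -> T, finite_mfun f' & forall g, g \in F ->
    forall P Q : pred T,
    `| fine (mu (a g @` [set x | P (f x)] `&` [set x | Q (f x)])) -
       fine (nu (b g @` [set y | P (f' y)] `&` [set y | Q (f' y)])) | <= e.
Proof.
move=> ab mf e0.
(* At most [#|{: T * T}|] errors add up; the successor keeps the denominator positive when [T] is
   empty. *)
pose e' := e / #|{: T * T}|.+1%:R.
have e'0 : 0 < e' by rewrite divr_gt0.
have pA := finite_mfun_partition (finite_mfun_comp enum_rank mf).
have [B pB ABe] := ab _ _ pA [set` F] (finite_seq F) _ e'0.
have [h mh Bh] := partition_finite_mfun pB.
exists (enum_val \o h); first exact: finite_mfun_comp.
have mf' := finite_mfun_comp enum_val mh.
move=> g Fg P Q; rewrite (finite_mfun_joint_pr a g P Q mf).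
rewrite (finite_mfun_joint_pr b g P Q mf') -sumrB.
apply: (le_trans (ler_norm_sum _ _ _)).
apply: (@le_trans _ _ (\sum_(u : T * T) e')); last first.
  rewrite sumr_const -mulr_natr /e' -mulrA ler_piMr ?(ltW e0)//.
  by rewrite mulrC ler_pdivrMr// mul1r ler_nat.
apply: ler_sum => -[s t] _ /=; rewrite -mulrBr normrM normr_nat.
apply: (@le_trans _ _ (1 * e')); last by rewrite mul1r.
apply: ler_pM => //; first by rewrite lern1 leq_b1.
have := ABe g Fg (enum_rank s) (enum_rank t).
have eqA u : [set x | (enum_rank \o f) x = enum_rank u] = [set x | f x = u].
  by apply/seteqP; split => x /= => [/enum_rank_inj|->].
have eqB u : B (enum_rank u) = [set y | (enum_val \o h) y = u].
  rewrite Bh; apply/seteqP; split => x /= => [->|<-].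
    exact: enum_rankK.
  by rewrite enum_valK.
rewrite !eqA !eqB.
have fA : mu (a g @` [set x | f x = s] `&` [set x | f x = t]) \is a fin_num.
  apply: fin_num_measure; rewrite -!eqA; case: pA => mA _ _.
  by apply: measurableI => //; exact: measurable_image_act.
have fB : nu (b g @` [set x | (enum_val \o h) x = s] `&`
    [set x | (enum_val \o h) x = t]) \is a fin_num.
  apply: fin_num_measure; rewrite -!eqB; case: pB => mB _ _.
  by apply: measurableI => //; exact: measurable_image_act.
move: fA fB => /fineK <- /fineK <-.
by rewrite -EFinB abse_EFin lte_fin => /ltW.
Qed.



End weak_containment.

(** * Slices of the product action *)

Section mean.
Context (R : realType) d (Z : measurableType d) (lambda : probability Z R).

(** Boundedness and the value of the integral travel together, so that the mean of a linear
    expression is found term by term. *)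
Definition has_mean (f : Z -> R) (m : R) :=
  bounded_mfun f /\ \int[lambda]_z f z = m.

Lemma has_mean_cst c : has_mean (fun=> c) c.
Proof. by split; [exact: bounded_mfun_cst|exact: RintegralT_cst]. Qed.

Lemma has_meanD f g m n : has_mean f m -> has_mean g n ->
  has_mean (fun z => f z + g z) (m + n).
Proof.
move=> [bf <-] [bg <-]; split; first exact: bounded_mfunD.
by rewrite RintegralD//; exact: bounded_mfun_integrable.
Qed.

Lemma has_meanZ c f m : has_mean f m -> has_mean (fun z => c * f z) (c * m).
Proof.
move=> [bf <-]; split.
  by apply: bounded_mfunM => //; exact: bounded_mfun_cst.
by rewrite RintegralZl//; exact: bounded_mfun_integrable.
Qed.

Lemma has_mean_sum I (s : seq I) (f : I -> Z -> R) (m : I -> R) :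
  (forall i, has_mean (f i) (m i)) ->
  has_mean (fun z => \sum_(i <- s) f i z) (\sum_(i <- s) m i).
Proof.
move=> fm; elim: s => [|i s IH].
  by under eq_fun do rewrite big_nil; rewrite big_nil; exact: has_mean_cst.
by under eq_fun do rewrite big_cons; rewrite big_cons; exact: has_meanD.
Qed.

Lemma has_mean_lt f m e : has_mean f m -> m < e -> exists z, f z < e.
Proof.
move=> [bf <-] me; apply: contrapT => /forallNP h.
move: me; apply/negP; rewrite -leNgt -[leLHS](RintegralT_cst lambda).
apply: le_Rintegral => //.
- exact/bounded_mfun_integrable/bounded_mfun_cst.
- exact: bounded_mfun_integrable.
- by move=> z _; rewrite leNgt; exact/negP.
Qed.

(** The product measure is by construction the integral of the measures of the slices. *)
Lemma has_mean_xsection d' (X : measurableType d') (mu : probability X R)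
    (C : set (Z * X)) : measurable C ->
  has_mean (fun z => fine (mu (xsection C z)))
    (fine (product_probability lambda mu C)).
Proof.
move=> mC; have fm z : mu (xsection C z) \is a fin_num.
  by apply: fin_num_measure; exact: measurable_xsection.
have mf := measurable_fun_xsection mu mC.
split; last first.
  by rewrite /Rintegral; congr fine; apply: eq_integral => z _; rewrite fineK.
split; first exact: measurableT_comp.
exists 1 => z; rewrite ger0_norm ?fine_ge0// -lee_fin fineK//.
by apply: probability_le1; exact: measurable_xsection.
Qed.

End mean.

Section defect.
Context (R : realType) (G : groupType).
Context d (X : measurableType d) (mu : probability X R) (a : mp_action G mu).

(* How far [a g @` P0] is from [P], plus a bound on the squared distance from
   [mu (P `&` P')] to [p]: the first three terms form the squared [L^2] distance
   from the [w]-average of the translates of [P `&` P'] to [p].  It is linear in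
   the measures involved, hence can be integrated slice by slice. *)
Definition defect (w : seq (R * G)) (p : R) (g : G) (P0 P P' : set X) : R :=
  autocorr a (P `&` P') w - 2 * p * fine (mu (P `&` P')) + p ^+ 2 +
  fine (mu (a g @` P0 `&` ~` P)) + fine (mu (a g @` (~` P0) `&` P)).

(** By [sqr_le_autocorr] the first three terms are at least $(\mu(P \cap P') - p)^2$. *)
Lemma defect_ge0 w p g P0 P P' : measurable P -> measurable P' -> weights w ->
  0 <= defect w p g P0 P P'.
Proof.
move=> mP mP' ww; have := sqr_le_autocorr a (measurableI _ _ mP mP') ww.
rewrite /defect; set q := autocorr _ _ _; set s := fine _ => sq.
do 2 rewrite addr_ge0 ?fine_ge0//.
by have := sqr_ge0 (s - p); rewrite sqrrB; lra.
Qed.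

(** The first three terms put $\mu(P \cap P')$ within $e/2$ of $p$; the last two bound the change
    from $P$ to $gP_0$, again by $e/2$. This explains the two entries of the minimum. *)
Lemma defect_ge w p g P0 P P' e : measurable P0 -> measurable P ->
  measurable P' -> weights w -> 0 < e ->
  defect w p g P0 P P' < Num.min ((e / 2) ^+ 2) (e / 2) ->
  `|p - fine (mu (a g @` P0 `&` P'))| < e.
Proof.
move=> m0 mP mP' ww e0.
have mD := measurableI _ _ mP mP'.
have := sqr_le_autocorr a mD ww.
rewrite /defect.
set C1 := a g @` P0 `&` ~` P; set C2 := a g @` (~` P0) `&` P.
set S := a g @` P0 `&` P'; set D := P `&` P'.
have mg0 := measurable_image_act a g m0.
have mS : measurable S := measurableI _ _ mg0 mP'.
have mC1 : measurable C1 by apply: (measurableI _ _ mg0); exact: measurableC.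
have mC2 : measurable C2.
  apply: (measurableI _ _ _ mP).
  exact/measurable_image_act/measurableC.
have pr_le U V W : measurable U -> measurable V -> measurable W ->
    U `<=` V `|` W -> fine (mu U) <= fine (mu V) + fine (mu W).
  move=> mU mV mW UVW; rewrite -fineD ?fin_num_measure//.
  apply: fine_le; rewrite ?fin_numD ?fin_num_measure//.
  apply: le_trans (measureU2 mu mV mW).
  by apply: le_measure; rewrite ?inE//; exact: measurableU.
have SD : fine (mu S) <= fine (mu D) + fine (mu C1).
  apply: pr_le => // x [gx Px].
  by have [?|?] := pselect (P x); [left|right].
have DS : fine (mu D) <= fine (mu S) + fine (mu C2).
  apply: pr_le => // x [Px Qx]; rewrite /S /C2 !image_act /=.
  by have [?|?] := pselect (P0 (a g^-1%g x)); [left|right].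
have C10 : 0 <= fine (mu C1) by exact: fine_ge0.
have C20 : 0 <= fine (mu C2) by exact: fine_ge0.
move: SD DS C10 C20.
set s := fine (mu S); set D' := fine (mu D); set c1 := fine (mu C1).
set c2 := fine (mu C2); set q := autocorr _ _ _.
move=> SD DS C10 C20 Dq; rewrite lt_min => /andP[l1 l2].
have sq : (D' - p) ^+ 2 < (e / 2) ^+ 2 by rewrite sqrrB; nra.
have : `|D' - p| < e / 2.
  rewrite -(@ltr_pXn2r _ 2) ?nnegrE ?divr_ge0 ?(ltW e0)//.
  by rewrite real_normK ?num_real.
have q0 : 0 <= (D' - p) ^+ 2 by exact: sqr_ge0.
rewrite sqrrB in q0.
by rewrite !ltr_norml => /andP[? ?]; apply/andP; split; lra.
Qed.

End defect.

Section slices.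
Context (R : realType) (G : groupType).
Context d (Z : measurableType d) (lambda : probability Z R).
Context d' (X : measurableType d') (mu : probability X R) (b : mp_action G mu).

Let c := prod_action (id_action G lambda) b.

(** The first coordinate is fixed, so the slice above [z] is moved within itself by [b]. *)
Lemma xsection_prod_act g (C : set (Z * X)) z :
  xsection (c g @` C) z = b g @` xsection C z.
Proof.
rewrite !image_act; apply/seteqP; split => x; by rewrite /xsection /= !inE.
Qed.

Lemma xsectionC (C : set (Z * X)) z : xsection (~` C) z = ~` xsection C z.
Proof. by apply/seteqP; split => x; rewrite /xsection /= !inE. Qed.

Lemma has_mean_autocorr (D : set (Z * X)) w : measurable D ->
  has_mean lambda (fun z => autocorr b (xsection D z) w) (autocorr c D w).
Proof.
move=> mD; apply: has_mean_sum => i; apply: has_mean_sum => j.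
apply: has_meanZ; under eq_fun do rewrite -xsection_prod_act -xsectionI.
apply: has_mean_xsection; apply: measurableI => //.
exact: measurable_image_act.
Qed.

Lemma has_mean_defect w p g (P0 P P' : set (Z * X)) :
  measurable P0 -> measurable P -> measurable P' ->
  has_mean lambda
    (fun z => defect b w p g (xsection P0 z) (xsection P z) (xsection P' z))
    (defect c w p g P0 P P').
Proof.
move=> m0 mP mP'; have mD := measurableI _ _ mP mP'.
have mP0C := measurableC m0.
rewrite /defect; under eq_fun do
  rewrite -!xsectionC -!xsection_prod_act -!xsectionI.
apply: has_meanD; last first.
  by apply/has_mean_xsection/measurableI => //; exact: measurable_image_act.
apply: has_meanD; last first.
  apply/has_mean_xsection/measurableI; last exact: measurableC.
  exact: measurable_image_act.
apply: has_meanD; last exact: has_mean_cst.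
apply: has_meanD; first exact: has_mean_autocorr.
rewrite -mulNr; under eq_fun do rewrite -mulNr.
exact/has_meanZ/has_mean_xsection.
Qed.

End slices.

Definition quotients (R : realType) (G : groupType) (w : seq (R * G)) :=
  [seq (j.2 * i.2^-1)%g | i <- w, j <- w].

(** The coefficients [i.1 * j.1] are nonnegative with sum 1, so errors at the elements of
    [quotients w] average to at most [e]. *)
Lemma autocorr_le (R : realType) (G : groupType)
    d (X : measurableType d) (mu : probability X R) (a : mp_action G mu)
    d' (Y : measurableType d') (nu : probability Y R) (b : mp_action G nu)
    (D : set X) (D' : set Y) (w : seq (R * G)) (e : R) :
  weights w ->
  (forall g, g \in quotients w ->
    `|fine (mu (a g @` D `&` D)) - fine (nu (b g @` D' `&` D'))| <= e) ->
  autocorr b D' w <= autocorr a D w + e.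
Proof.
move=> /andP[/allP w0 /eqP w1] De.
have -> : e = \sum_(i <- w) \sum_(j <- w) i.1 * j.1 * e.
  under eq_bigr do rewrite -mulr_suml -mulr_sumr w1 mulr1.
  by rewrite -mulr_suml w1 mul1r.
rewrite -big_split/= /autocorr !big_seq; apply: ler_sum => i iw.
rewrite -big_split/= !big_seq; apply: ler_sum => j jw.
rewrite -mulrDr ler_wpM2l ?mulr_ge0 ?w0//.
have := De (j.2 * i.2^-1)%g; rewrite ler_norml => /(_ _)/andP[|+ _].
  by apply/allpairsP; exists (i, j).
by lra.
Qed.

Theorem theorem1p2 (R : realType) (G : groupType)
    (dX : measure_display) (X : measurableType dX) (mu : probability X R)
    (dZ : measure_display) (Z : measurableType dZ) (lambda : probability Z R)
    (a b : mp_action G mu) :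
  countable [set: G] ->
  standard_borel R X ->
  standard_borel R Z ->
  nonatomic lambda ->
  ergodic a ->
  weakly_contained a (prod_action (id_action G lambda) b) ->
  weakly_contained a b.
Proof.
move=> cG _ _ _ erg ac k A pA F /finite_seqP[s ->] e e0.
set c := prod_action _ _ in ac.
have [al mal Aal] := partition_finite_mfun pA.
pose S : finType := seq_sub (1%g :: s).
pose one : S := SeqSub (mem_head 1%g s).
pose T : finType := {ffun S -> 'I_k}.
pose f (x : X) : T := [ffun h => al (a (val h)^-1%g x)].
have mf : finite_mfun f.
  apply: finite_mfunP => phi.
  have -> : [set x | f x = phi] =
      \bigcap_(h in [set: S]) (a (val h)^-1%g @^-1` [set x | al x == phi h]).
    apply/seteqP; split => [x <- h _ /=|x fx]; first by rewrite ffunE.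
    by apply/ffunP => h; rewrite ffunE; apply/eqP/fx.
  apply: fin_bigcap_measurable => // h _; apply: measurable_preimage_act.
  exact: (mal (fun i => i == phi h)).
pose I : finType := (S * 'I_k * 'I_k)%type.
pose P0 (u : I) (t : T) := t one == u.1.2.
pose P (u : I) (t : T) := t u.1.1 == u.1.2.
pose P' (u : I) (t : T) := t one == u.2.
have fP0 i x : (f x one == i) = (al x == i).
  by rewrite ffunE /= invg1 act1.
have fP h i : [set x | f x h == i] = a (val h) @` [set x | f x one == i].
  by rewrite image_act; apply/seteqP; split => x /=; rewrite fP0 ffunE.
pose D u := [set x | (P u (f x)) && (P' u (f x))].
pose p u := fine (mu (D u)).
have mD u : measurable (D u) by exact: (mf (fun t => P u t && P' u t)).
have p01 u : 0 <= p u <= 1.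
  rewrite fine_ge0//= -lee_fin fineK ?fin_num_measure//.
  exact: probability_le1.
pose m := Num.min ((e / 2) ^+ 2) (e / 2).
have m0 : 0 < m by rewrite lt_min exprn_gt0 divr_gt0.
pose N : R := \sum_(u : I) 1.
have N0 : 0 <= N by exact: sumr_ge0.
(* With each of the [N] defects at most [6 * eta], their sum stays strictly below [m], even when [N]
   is 0. *)
pose eta := m / (6 * (N + 1)).
have eta0 : 0 < eta by rewrite divr_gt0// mulr_gt0// ltr_wpDl.
have /choice[w ww] u : exists w, weights w /\
    autocorr a (D u) w < p u ^+ 2 + eta.
  by have [w] := ergodic_autocorr (mD u) cG erg eta0; exists w.
(* The identity controls the measures of the sets [D u], the elements of [s] the translates, and the
   quotients the autocorrelations. *)
pose H := (1%g :: s) ++ flatten [seq quotients (w u) | u <- enum I].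
have [f' mf' ff'] := weakly_contained_mfun H ac mf eta0.
have setC_pred V (g : V -> T) (Q : pred T) :
  [set x | ~~ Q (g x)] = ~` [set x | Q (g x)].
  by apply/seteqP; split => x /negP.
have setI_pred V (g : V -> T) (Q Q' : pred T) :
  [set x | Q (g x) && Q' (g x)] = [set x | Q (g x)] `&` [set x | Q' (g x)].
  by apply/seteqP; split => x /andP.
pose total := \sum_u defect c (w u) (p u) (val u.1.1)
  [set y | P0 u (f' y)] [set y | P u (f' y)] [set y | P' u (f' y)].
have total_lt : total < m.
  (* The autocorrelation exceeds [p u ^+ 2] by at most [2 * eta], the linear term costs [2 * eta]
     because [p u <= 1], and the two translation errors cost [eta] each, since they vanish exactly
     in [X]. *)
  have : total <= \sum_(u : I) 6 * eta.
    rewrite /total; apply: ler_sum => u _.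
    have [wu wlt] := ww u.
    have H1 : val u.1.1 \in H by rewrite mem_cat (valP u.1.1).
    have fD : autocorr c [set y | P u (f' y) && P' u (f' y)] (w u) <=
        autocorr a (D u) (w u) + eta.
      apply: autocorr_le => // g gw.
      apply: (ff' g _ (fun t => P u t && P' u t) (fun t => P u t && P' u t)).
      rewrite mem_cat; apply/orP; right; apply/flattenP.
      by exists (quotients (w u)) => //; apply: map_f; rewrite mem_enum.
    have := ff' 1%g _ (fun t => P u t && P' u t) (fun t => P u t && P' u t).
    rewrite !image_act1 !setIid -/(D u) -/(p u) => /(_ (mem_head _ _)).
    rewrite ler_norml => /andP[_ Du].
    have imP : a (val u.1.1) @` [set x | P0 u (f x)] = [set x | P u (f x)].
      by rewrite -fP.
    have imPC : a (val u.1.1) @` [set x | ~~ P0 u (f x)] =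
        [set x | ~~ P u (f x)].
      by rewrite !setC_pred -imP !image_act preimage_setC.
    have := ff' _ H1 (P0 u) (fun t => ~~ P u t).
    rewrite imP !setC_pred setICr measure0 sub0r normrN => C1.
    have := ff' _ H1 (fun t => ~~ P0 u t) (P u).
    rewrite imPC !setC_pred setICl measure0 sub0r normrN => C2.
    have {}C1 := le_trans (ler_norm _) C1.
    have {}C2 := le_trans (ler_norm _) C2.
    move: fD Du; rewrite setI_pred /defect => fD Du.
    by have /andP[? ?] := p01 u; nra.
  move=> /le_lt_trans; apply.
  under eq_bigr do rewrite -[6 * eta]mulr1.
  rewrite -mulr_sumr -/N (_ : 6 * eta * N = m * (N / (N + 1))).
    by rewrite gtr_pMr// ltr_pdivrMr ?mul1r ?ltrDl// ltr_wpDl.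
  by rewrite /eta; field; rewrite gt_eqF// ltr_wpDl.
(* The slices' total defect has mean [total], so a single [z] is good for all [u] at once. *)
have [z zlt] := has_mean_lt (has_mean_sum (index_enum I) (fun u =>
  has_mean_defect lambda b (w u) (p u) (val u.1.1)
    (mf' (P0 u)) (mf' (P u)) (mf' (P' u)))) total_lt.
have mf'z : finite_mfun (fun x => f' (z, x)).
  move=> Q; have := measurable_xsection z (mf' Q).
  by congr measurable; apply/seteqP; split => x; rewrite /xsection /= inE.
have xs (Q : pred T) :
    xsection [set y | Q (f' y)] z = [set x | Q (f' (z, x))].
  by apply/seteqP; split => x; rewrite /xsection /= inE.
(* The wanted partition is the [one] coordinate of the labelling on the chosen slice. *)
exists (fun i => [set x | f' (z, x) one = i]).
  exact: (finite_mfun_partition (finite_mfun_comp (fun t : T => t one) mf'z)).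
move=> g Fg i j.
have gS : g \in 1%g :: s by rewrite in_cons; apply/orP; right.
pose u : I := (SeqSub gS, i, j).
have : defect b (w u) (p u) g (xsection [set y | P0 u (f' y)] z)
    (xsection [set y | P u (f' y)] z) (xsection [set y | P' u (f' y)] z) < m.
  (* Defects are nonnegative, so each one is bounded by their sum. *)
  apply: le_lt_trans zlt; rewrite (bigD1 u)//= lerDl sumr_ge0// => v _.
  by rewrite !xs; apply: defect_ge0; [exact: mf'z|exact: mf'z|case: (ww v)].
rewrite !xs => /defect_ge.
move=> /(_ (mf'z _) (mf'z _) (mf'z _) (proj1 (ww u)) e0).
have eqB l : [set x | f' (z, x) one == l] = [set x | f' (z, x) one = l].
  by apply/seteqP; split => x /eqP.
have eqA l : [set x | f x one == l] = A l.
  by rewrite Aal; apply/seteqP; split => x /=; rewrite fP0 => /eqP.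
have -> : p u = fine (mu (a g @` A i `&` A j)).
  by rewrite /p /D setI_pred -!eqA -(fP (SeqSub gS)).
rewrite /P0 /P' /= !eqB => lt_e.
have mA l : measurable (A l) by case: pA.
have mB l : measurable [set x | f' (z, x) one = l].
  by rewrite -eqB; exact: (mf'z (fun t => t one == l)).
have /fineK <- : mu (a g @` A i `&` A j) \is a fin_num.
  by apply/fin_num_measure/measurableI => //; exact: measurable_image_act.
have /fineK <- : mu (b g @` [set x | f' (z, x) one = i] `&`
    [set x | f' (z, x) one = j]) \is a fin_num.
  by apply/fin_num_measure/measurableI => //; exact: measurable_image_act.
by rewrite -EFinB abse_EFin lte_fin.
Qed.
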